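(* Let $R$ be a discrete valuation ring with uniformizer $\pi$ and fraction field $K$. Let $\mathcal{F}$ be a network sheaf on a finite graph $G$ whose stalks are finite-rank free $R$-modules, with coboundary $d:C^0(G;\mathcal{F})\to C^1(G;\mathcal{F})$. The saturation $$\mathrm{sat}(\mathrm{im}\,d):=(\mathrm{im}\,d\otimes_R K)\cap C^1(G;\mathcal{F})$$ is the unique minimal direct summand of $C^1(G;\mathcal{F})$ containing $\mathrm{im}\,d$. Let $U,V$ be invertible matrices over $R$ such that $U[d]V=\mathrm{diag}(\pi^{a_1},\ldots,\pi^{a_r},0,\ldots,0)$ with $0\le a_1\le\cdots\le a_r$ and $r=\mathrm{rank}_R(d)$. Then $U,V$ induce integral idempotent matrices (entries in $R$) $$\Pi_{\ker}\in\mathrm{End}(C^0(G;\mathcal{F})),\qquad \Pi_{\mathrm{sat}},\ \Pi_{\mathrm{free}}\in\mathrm{End}(C^1(G;\mathcal{F})),\qquad \Pi_{\mathrm{free}}:=\mathrm{Id}-\Pi_{\mathrm{sat}},$$ such that: (i) $\mathrm{im}(\Pi_{\ker})=\ker d=H^0(G;\mathcal{F})$; (ii) $\mathrm{im}(\Pi_{\mathrm{sat}})=\mathrm{sat}(\mathrm{im}\,d)$; (iii) the quotient map $q:C^1(G;\mathcal{F})\to H^1(G;\mathcal{F})$ restricts to an isomorphism from $\mathrm{im}(\Pi_{\mathrm{free}})$ onto $H^1(G;\mathcal{F})_{\mathrm{free}}$, the free part of $H^1(G;\mathcal{F})$; (iv) $\mathrm{sat}(\mathrm{im}\,d)/\mathrm{im}\,d\cong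 H^1(G;\mathcal{F})_{\mathrm{tors}}$. Moreover, for all $k\ge 1$, reduction modulo $\pi^k$ commutes with $\Pi_{\ker},\Pi_{\mathrm{sat}},\Pi_{\mathrm{free}}$.
   Context: A network sheaf $\mathcal{F}$ of $R$-modules on a finite graph $G=(V,E)$ assigns an $R$-module to each vertex and each edge (the stalks) and an $R$-linear restriction map $\mathcal{F}_{v\to e}:\mathcal{F}(v)\to\mathcal{F}(e)$ to each incidence of a vertex $v$ with an edge $e$. $C^0(G;\mathcal{F})=\prod_v\mathcal{F}(v)$, $C^1(G;\mathcal{F})=\prod_e\mathcal{F}(e)$, and, fixing edge orientations, $(ds)(e)=\mathcal{F}_{u\to e}(s(u))-\mathcal{F}_{v\to e}(s(v))$ for $e:u\to v$. $H^0=\ker d$, $H^1=C^1/\mathrm{im}\,d$. Identify $C^0\cong R^{n_0}$ and $C^1\cong R^{n_1}$ by choosing bases; $[d]$ is the resulting $n_1\times n_0$ matrix. Induced idempotents: with $E_0=\mathrm{diag}(0,\ldots,0,1,\ldots,1)$ ($r$ zeros, $n_0-r$ ones) and $E_1=\mathrm{diag}(1,\ldots,1,0,\ldots,0)$ ($r$ ones, $n_1-r$ zeros), set $\Pi_{\ker}=VE_0V^{-1}$, $\Pi_{\mathrm{sat}}=U^{-1}E_1U$. $M_{\mathrm{tors}}$ is the torsion submodule of $M$; $M_{\mathrm{free}}$ denotes a free part of a finitely generated module $M$, i.e. a free submodule with $M=M_{\mathrm{free}}\oplus M_{\mathrm{tors}}$; item (iii) means that $q$ is injective on $\mathrm{im}(\Pi_{\mathrm{free}})$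 with image such a free complement of $H^1(G;\mathcal{F})_{\mathrm{tors}}$ (equivalently, composing with the quotient gives an isomorphism onto $H^1/H^1_{\mathrm{tors}}$). ''Reduction modulo $\pi^k$ commutes with $\Pi$'' means that $(\Pi x)\bmod \pi^k=(\Pi\bmod\pi^k)(x\bmod\pi^k)$ for all cochains $x$. *)

(* Defs.v *)
From HB Require Import structures.
From mathcomp Require Import all_boot all_order all_algebra.
From mathcomp Require Import ring_quotient fraction generic_quotient.
From mathcomp Require Import boolp classical_sets functions.

Set Implicit Arguments.
Unset Strict Implicit.
Unset Printing Implicit Defensive.
Import GRing.Theory.
Local Open Scope ring_scope.
Local Open Scope quotient_scope.
Local Open Scope classical_set_scope.

#[local] Obligation Tactic := idtac.

Section Submodules.
Variable R : nzRingType.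

Record submod (M : lmodType R) := Submod {
  carrier :> set M;
  submod0 : carrier 0;
  submodP : forall (a : R) (x y : M),
    carrier x -> carrier y -> carrier (a *: x + y)
}.

Section SubmodulePredicate.
Variable M : lmodType R.
Implicit Type N : submod M.

Definition submod_pred N : M -> bool := fun x => `[< carrier N x >].

Lemma submod_pred_closed N : submod_closed (submod_pred N).
Proof.
split=> [|a x y]; first exact/asboolP/submod0.
by move=> /asboolP Nx /asboolP Ny; apply/asboolP/submodP.
Qed.

HB.instance Definition _ N :=
  GRing.isSubmodClosed.Build R M (submod_pred N) (submod_pred_closed N).

Definition submod_zmod N : zmodClosed M :=
  GRing.ZmodClosed.clone M (submod_pred N) _.

End SubmodulePredicate.

Section SubmoduleType.
Variables (M : lmodType R) (N : submod M).

Record submod_sort := SubmodSort {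
  submod_val : M;
  submod_valP : submod_val \in submod_pred N
}.

HB.instance Definition _ := [isSub for submod_val].
HB.instance Definition _ := [Choice of submod_sort by <:].
HB.instance Definition _ := [SubChoice_isSubLmodule of submod_sort by <:].

End SubmoduleType.

Section QuotientModule.
Variables (M : lmodType R) (N : submod M).

Definition quotmod := Quotient.quot (submod_zmod N).

HB.instance Definition _ := GRing.Zmodule.on quotmod.

Definition quotmod_scale (a : R) (x : quotmod) : quotmod :=
  \pi_(Quotient.quot (submod_zmod N)) (a *: repr x).

Definition quot_map (x : M) : quotmod := \pi_(Quotient.quot (submod_zmod N)) x.

Lemma quot_mapD : {morph quot_map : x y / x + y}.
Proof. by move=> x y; rewrite /quot_map raddfD. Qed.

Lemma quotmod_scaleE a x : quotmod_scale a (quot_map x) = quot_map (a *: x).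
Proof.
apply/eqP; rewrite /quotmod_scale /quot_map -Quotient.idealrBE -scalerBr.
by apply: rpredZ; rewrite Quotient.idealrBE reprK.
Qed.

Lemma quot_mapK (x : quotmod) : exists y, x = quot_map y.
Proof. by exists (repr x); rewrite /quot_map reprK. Qed.

Lemma quotmod_scaleA a b x :
  quotmod_scale a (quotmod_scale b x) = quotmod_scale (a * b) x.
Proof. by have [y ->] := quot_mapK x; rewrite !quotmod_scaleE scalerA. Qed.

Lemma quotmod_scale1 : left_id 1 quotmod_scale.
Proof.
by move=> x; have [y ->] := quot_mapK x; rewrite quotmod_scaleE scale1r.
Qed.

Lemma quotmod_scaleDr : right_distributive quotmod_scale +%R.
Proof.
move=> a x y; have [[x' ->] [y' ->]] := (quot_mapK x, quot_mapK y).
by rewrite -quot_mapD !quotmod_scaleE scalerDr quot_mapD.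
Qed.

Lemma quotmod_scaleDl x : {morph quotmod_scale^~ x : a b / a + b}.
Proof.
move=> a b; have [y ->] := quot_mapK x.
by rewrite /= !quotmod_scaleE scalerDl quot_mapD.
Qed.

HB.instance Definition _ := GRing.Zmodule_isLmodule.Build R quotmod
  quotmod_scaleA quotmod_scale1 quotmod_scaleDr quotmod_scaleDl.

Lemma quot_map_linear : linear quot_map.
Proof. by move=> a x y; rewrite quot_mapD -quotmod_scaleE. Qed.

HB.instance Definition _ :=
  GRing.isLinear.Build R M quotmod *:%R quot_map quot_map_linear.

Lemma quot_map_eq0 x : quot_map x = 0 <-> carrier N x.
Proof.
rewrite -(raddf0 quot_map); split=> [/eqP|Nx].
  by rewrite -Quotient.idealrBE subr0 => /asboolP.
by apply/eqP; rewrite -Quotient.idealrBE subr0; apply/asboolP.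
Qed.

End QuotientModule.

Section LinearMaps.
Variables (M M' : lmodType R) (f : {linear M -> M'}).

Program Definition range_submod : submod M' := @Submod M' (range f) _ _.
Next Obligation. by exists 0; rewrite ?linear0. Qed.
Next Obligation.
by move=> a _ _ [x _ <-] [y _ <-]; exists (a *: x + y); rewrite ?linearP.
Qed.

Program Definition preim_submod (N : submod M') : submod M :=
  @Submod M (f @^-1` N) _ _.
Next Obligation. by move=> N; rewrite /preimage /= linear0; apply: submod0. Qed.
Next Obligation.
by move=> N a x y; rewrite /preimage /= linearP; apply: submodP.
Qed.

Program Definition ker_submod : submod M :=
  @Submod M [set x | f x = 0] _ _.
Next Obligation. exact: linear0. Qed.
Next Obligation. by move=> a x y /= fx fy; rewrite linearP fx fy scaler0 addr0. Qed.

End LinearMaps.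

(* The quotient N / N'; the map [submod_sort N -> M] being the inclusion, the
   denominator is really the intersection of N and N'. *)
Definition subquot (M : lmodType R) (N N' : submod M) :=
  quotmod (preim_submod (val : {linear submod_sort N -> M}) N').

Definition isomorphic (M M' : lmodType R) :=
  exists f : {linear M -> M'}, bijective f.

Definition complementary (M : lmodType R) (S T : set M) :=
  S `&` T = [set 0] /\
  forall x, exists s t, [/\ S s, T t & x = s + t].

Definition direct_summand (M : lmodType R) (S : submod M) :=
  exists T : submod M, complementary S T.

Definition minimal_summand_containing (M : lmodType R) (N S : submod M) :=
  [/\ direct_summand S, N `<=` S &
      forall T : submod M, direct_summand T -> N `<=` T -> T `<=` S ->
        T = S :> set M].

Definition unique_minimal_summand_containing (M : lmodType R)
    (N S : submod M) :=
  minimal_summand_containing N S /\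
  forall T : submod M, minimal_summand_containing N T -> T = S :> set M.

(* An ordered basis of M, given by the isomorphism it induces with R^n. *)
Record basis (M : lmodType R) (n : nat) := Basis {
  coords : {linear M -> 'cV[R]_n};
  vec : {linear 'cV[R]_n -> M};
  coordsK : cancel coords vec;
  vecK : cancel vec coords
}.

Definition free_of_finite_rank (M : lmodType R) :=
  exists n, inhabited (basis M n).

End Submodules.

Section Matrices.
Variable R : comNzRingType.

Definition matrix_of (M M' : lmodType R) n n' (b : basis M n)
    (b' : basis M' n') (f : {linear M -> M'}) : 'M[R]_(n', n) :=
  \matrix_(i, j) coords b' (f (vec b (delta_mx j 0))) i 0.

Definition endo_of (M : lmodType R) n (b : basis M n) (A : 'M[R]_n) :
    {linear M -> M} :=
  vec b \o mulmx A \o coords b.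

Definition smith_mx (pi : R) n1 n0 r (a : r.-tuple nat) : 'M[R]_(n1, n0) :=
  \matrix_(i, j) (if (i == j :> nat) && (i < r)%N then pi ^+ nth 0%N a i else 0).

Definition first_ones n r : 'M[R]_n := diag_mx (\row_i (i < r)%N%:R).
Definition last_ones n r : 'M[R]_n := diag_mx (\row_i (r <= i)%N%:R).

End Matrices.

Section IntegralDomain.
Variable R : idomainType.

Definition toK m n (A : 'M[R]_(m, n)) : 'M[{fraction R}]_(m, n) :=
  map_mx (@tofrac R) A.

(* (N (x)_R K) `&` M, for N a submodule of a free module M: the basis b
   identifies M (x)_R K with K^n, in which M is R^n and N (x)_R K is the
   K-span of N. *)
Program Definition saturation (M : lmodType R) n (b : basis M n)
    (N : submod M) : submod M :=
  @Submod R M [set x | exists m (y : 'I_m -> M) (c : 'I_m -> {fraction R}),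
    (forall i, carrier N (y i)) /\
    toK (coords b x) = \sum_i c i *: toK (coords b (y i))] _ _.
Next Obligation.
move=> M n b N; exists 0%N, (fun=> 0), (fun=> 0); split=> [[]//|].
by rewrite big_ord0 linear0 /toK map_mx0.
Qed.
Next Obligation.
move=> M n b N a x y [m1 [y1 [c1 [N1 e1]]]] [m2 [y2 [c2 [N2 e2]]]].
exists (m1 + m2)%N, (fun i => match fintype.split i with inl j => y1 j | inr j => y2 j end),
  (fun i => match fintype.split i with inl j => tofrac a * c1 j | inr j => c2 j end).
split=> [i|]; first by case: (fintype.split i).
rewrite linearP /toK map_mxD map_mxZ -!/(toK _) e1 e2 big_split_ord /=.
rewrite scaler_sumr; congr (_ + _); apply: eq_bigr => i _.
- by rewrite (unsplitK (inl _ i)) scalerA.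
- by rewrite (unsplitK (inr _ i)).
Qed.

Lemma coords_change (M : lmodType R) n n' (b : basis M n) (b' : basis M n') x :
  coords b' x = matrix_of b b' idfun *m coords b x.
Proof.
rewrite -{1}(coordsK b x); set v := coords b x.
rewrite {1}(matrix_sum_delta v) !linear_sum /=; apply/matrixP => i k.
rewrite ord1 summxE !mxE; apply: eq_bigr => j _.
by rewrite big_ord_recl big_ord0 addr0 !linearZ /= !mxE mulrC ord1.
Qed.

Lemma saturation_basis_irrelevant (M : lmodType R) n n' (b : basis M n)
    (b' : basis M n') (N : submod M) :
  saturation b N = saturation b' N :> set M.
Proof.
suff incl p q (b1 : basis M p) (b2 : basis M q) :
    saturation b1 N `<=` saturation b2 N by apply/seteqP; split; apply: incl.
move=> x [m [y [c [Ny e]]]]; exists m, y, c; split=> //.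
rewrite (coords_change b1) /toK map_mxM -!/(toK _) e mulmx_sumr.
by apply: eq_bigr => i _; rewrite (coords_change b1 b2) /toK map_mxM scalemxAr.
Qed.

Program Definition torsion (M : lmodType R) : submod M :=
  @Submod R M [set x | exists2 a : R, a != 0 & a *: x = 0] _ _.
Next Obligation. by move=> M; exists 1; rewrite ?oner_neq0 ?scaler0. Qed.
Next Obligation.
move=> M a x y [b b0 bx] [c c0 cy]; exists (b * c); first exact: mulf_neq0.
rewrite scalerDr -[X in _ + X]scalerA cy scaler0 addr0 scalerA.
by rewrite mulrAC mulrC [b * a]mulrC !mulrA -scalerA bx scaler0.
Qed.

Definition free_part (M : lmodType R) (L : submod M) :=
  free_of_finite_rank (submod_sort L) /\ complementary L (torsion M).

Definition ideal := submod R^o.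

Definition generated_by (I : ideal) (x : R) :=
  I = [set a * x | a in setT] :> set R.

Definition prime_ideal (I : ideal) :=
  ~ carrier I 1 /\
  forall x y : R, carrier I (x * y) -> carrier I x \/ carrier I y.

Definition nonzero_prime_ideal (I : ideal) :=
  prime_ideal I /\ I <> [set 0] :> set R.

Definition principal_ideal_domain :=
  forall I : ideal, exists x, generated_by I x.

Definition discrete_valuation_ring :=
  principal_ideal_domain /\
  exists m : ideal, nonzero_prime_ideal m /\
    forall I : ideal, nonzero_prime_ideal I -> I = m :> set R.

(* In a discrete valuation ring: pi generates the maximal ideal. *)
Definition uniformizer (pi : R) :=
  exists2 m : ideal, nonzero_prime_ideal m & generated_by m pi.

Lemma uniformizer_nonunit pi : uniformizer pi -> pi \isn't a GRing.unit.
Proof.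
move=> [m [[m1 _] _] gm]; apply/negP => piU; apply: m1; rewrite gm.
by exists pi^-1; rewrite ?mulVr.
Qed.

Section ResidueRing.
Variables (pi : R) (hpi : uniformizer pi) (k : nat) (hk : (0 < k)%N).

Definition power_ideal of uniformizer pi & (0 < k)%N : pred R :=
  fun x => `[< exists y, x = y * pi ^+ k >].

Lemma power_idealP : idealr_closed (power_ideal hpi hk).
Proof.
split.
- by apply/asboolP; exists 0; rewrite mul0r.
- apply/asboolP => -[y e1]; have /negP := uniformizer_nonunit hpi; apply.
  have : y * pi ^+ k \is a GRing.unit by rewrite -e1 unitr1.
  by rewrite unitrM unitrX_pos // => /andP[].
- move=> a _ _ /asboolP[x ->] /asboolP[y ->]; apply/asboolP.
  by exists (a * x + y); rewrite mulrDl mulrA.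
Qed.

HB.instance Definition _ := isIdealr.Build R (power_ideal hpi hk) power_idealP.

Definition power_idealr : idealr R := Idealr.clone R (power_ideal hpi hk) _.

Definition residue_ring := {ideal_quot power_idealr}.

HB.instance Definition _ := GRing.ComNzRing.on residue_ring.

Definition residue (x : R) : residue_ring :=
  \pi_({ideal_quot power_idealr}) x.

Lemma residue_is_zmod_morphism : zmod_morphism residue.
Proof. by move=> x y; rewrite /residue raddfB. Qed.
Lemma residue_is_monoid_morphism : monoid_morphism residue.
Proof. by split=> [|x y]; rewrite /residue ?rmorph1 ?rmorphM. Qed.

HB.instance Definition _ :=
  GRing.isZmodMorphism.Build R residue_ring residue residue_is_zmod_morphism.
HB.instance Definition _ :=
  GRing.isMonoidMorphism.Build R residue_ring residue residue_is_monoid_morphism.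

Lemma residue_eq0 x : residue x = 0 <-> exists y, x = y * pi ^+ k.
Proof.
rewrite -(raddf0 residue); split=> [/eqP|xI].
  by rewrite -Quotient.idealrBE subr0 => /asboolP.
by apply/eqP; rewrite -Quotient.idealrBE subr0; apply/asboolP.
Qed.


(* The reduction modulo pi^k of a matrix, or of the coordinates of a cochain. *)
Definition residue_mx m n (A : 'M[R]_(m, n)) : 'M[residue_ring]_(m, n) :=
  map_mx residue A.

End ResidueRing.
End IntegralDomain.

(* A finite graph, loops and multiple edges allowed.  The incidences of an edge
   e are its two ends (e, false) and (e, true); a loop thus has two. *)
Record graph := Graph {
  vertex : finType;
  edge : finType;
  endpoint : edge -> bool -> vertex
}.

(* A vectType is a module isomorphic to some R^n, i.e., free of finite rank. *)
Record sheaf (R : nzRingType) (G : graph) := Sheaf {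
  vstalk : vertex G -> vectType R;
  estalk : edge G -> vectType R;
  restr : forall (e : edge G) (i : bool),
    {linear vstalk (endpoint e i) -> estalk e}
}.

(* The end of each edge chosen as its source u, in d s e = F_u s_u - F_v s_v. *)
Definition orientation (G : graph) := edge G -> bool.

Section Product.
Variables (R : nzRingType) (I : finType) (M : I -> lmodType R).

Definition prodmod := {dffun forall i, M i}.

HB.instance Definition _ := Choice.on prodmod.

Implicit Types f g : prodmod.

Definition prodmod0 : prodmod := [ffun i => 0 : M i].
Definition prodmodN f : prodmod := [ffun i => - f i].
Definition prodmodD f g : prodmod := [ffun i => f i + g i].
Definition prodmodZ (a : R) f : prodmod := [ffun i => a *: f i].

Lemma prodmodDA : associative prodmodD.
Proof. by move=> f g h; apply/ffunP => i; rewrite !ffunE addrA. Qed.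
Lemma prodmodDC : commutative prodmodD.
Proof. by move=> f g; apply/ffunP => i; rewrite !ffunE addrC. Qed.
Lemma prodmod0D : left_id prodmod0 prodmodD.
Proof. by move=> f; apply/ffunP => i; rewrite !ffunE add0r. Qed.
Lemma prodmodND : left_inverse prodmod0 prodmodN prodmodD.
Proof. by move=> f; apply/ffunP => i; rewrite !ffunE addNr. Qed.

HB.instance Definition _ :=
  GRing.isZmodule.Build prodmod prodmodDA prodmodDC prodmod0D prodmodND.

Lemma prodmodZA a b f : prodmodZ a (prodmodZ b f) = prodmodZ (a * b) f.
Proof. by apply/ffunP => i; rewrite !ffunE scalerA. Qed.
Lemma prodmod1Z : left_id 1 prodmodZ.
Proof. by move=> f; apply/ffunP => i; rewrite !ffunE scale1r. Qed.
Lemma prodmodZDr : right_distributive prodmodZ +%R.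
Proof. by move=> a f g; apply/ffunP => i; rewrite !ffunE scalerDr. Qed.
Lemma prodmodZDl f : {morph prodmodZ^~ f : a b / a + b}.
Proof. by move=> a b; apply/ffunP => i; rewrite !ffunE scalerDl. Qed.

HB.instance Definition _ := GRing.Zmodule_isLmodule.Build R prodmod
  prodmodZA prodmod1Z prodmodZDr prodmodZDl.

End Product.

Section Cochains.
Variables (R : nzRingType) (G : graph) (F : sheaf R G) (o : orientation G).

Definition C0 := prodmod (vstalk F).
Definition C1 := prodmod (estalk F).
HB.instance Definition _ := GRing.Lmodule.on C0.
HB.instance Definition _ := GRing.Lmodule.on C1.

Definition coboundary (s : C0) : C1 :=
  [ffun e => restr F e (o e) (s (endpoint e (o e)))
           - restr F e (~~ o e) (s (endpoint e (~~ o e)))].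

Lemma coboundary_linear : linear coboundary.
Proof.
move=> a s t; apply/ffunP => e; rewrite [LHS]ffunE !ffunE !(linearP (restr F e _)) scalerBr.
by rewrite opprD addrACA.
Qed.

HB.instance Definition _ :=
  GRing.isLinear.Build R C0 C1 *:%R coboundary coboundary_linear.

Definition H0 : submod C0 := ker_submod coboundary.
Definition H1 := quotmod (range_submod coboundary).

End Cochains.

(* Main.v *)
(* Since U D V = S is diagonal, with W the diagonal matrix of entries pi^(N - a_i)
   the matrix D' = V W U satisfies D D' = pi^N Psat and D' D = pi^N (1 - Pker),
   while Psat D = D and D Pker = 0.  As the modules are torsion-free, these four
   identities alone determine the images of Pker and Psat, an element x lying
   in the saturation of N iff s x is in N for some s != 0.  The latter also
   identifies sat(N) / N with the torsion of M / N.

   That sat(im d) is a direct summand does not use a Smith form: it is the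
   kernel of a matrix over R (the cokernel of d over K, with denominators
   cleared), and over a PID kernels of matrices are direct summands. *)
Require Import Defs.
From HB Require Import structures.
From mathcomp Require Import all_boot all_order all_algebra.
From mathcomp Require Import generic_quotient fraction boolp classical_sets functions.

Set Implicit Arguments.
Unset Strict Implicit.
Unset Printing Implicit Defensive.
Import GRing.Theory.
Local Open Scope ring_scope.
Local Open Scope classical_set_scope.

(** * Linear maps, their inverses and quotient modules *)

(** Functions built inside a proof, such as inverses obtained by choice, carry no canonical linear
    structure; this packs one. *)
Lemma linear_pack (R : nzRingType) (M M' : lmodType R) (f : M -> M') :
  linear f -> {g : {linear M -> M'} | forall x, g x = f x}.
Proof.
move=> fL; pose fM := GRing.isLinear.Build _ _ _ _ f fL.
by exists (HB.pack_for {linear M -> M'} f fM).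
Qed.

Lemma linear_inverse (R : nzRingType) (M M' : lmodType R) (f : {linear M -> M'}) :
  (forall x, f x = 0 -> x = 0) -> (forall y, exists x, f x = y) ->
  exists g : {linear M' -> M}, cancel f g /\ cancel g f.
Proof.
move=> f0 /choice[h fK]; have finj : injective f.
  move=> x y /eqP; rewrite -subr_eq0 -linearB => /eqP/f0/eqP.
  by rewrite subr_eq0 => /eqP.
have hK : cancel f h by move=> x; apply: finj.
have [g gE] := linear_pack (can2_linear hK fK).
by exists g; split=> x; rewrite gE.
Qed.

Lemma corestrict (R : nzRingType) (M M' : lmodType R) (N : submod M')
    (f : {linear M -> M'}) :
  (forall x, carrier N (f x)) ->
  {g : {linear M -> submod_sort N} | forall x, submod_val (g x) = f x}.
Proof.
move=> fN.
have fN' x : f x \in submod_pred N by apply/asboolP/fN.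
have gL : linear (fun x => SubmodSort (fN' x)).
  by move=> a x y; apply: val_inj; rewrite [RHS]linearP; exact: linearP.
by have [g gE] := linear_pack gL; exists g => x; rewrite gE.
Qed.

(** First isomorphism theorem: [f] is constant on the classes of [N], so that evaluating it on
    representatives is linear. *)
Lemma quotmod_isomorphic (R : nzRingType) (M M' : lmodType R) (N : submod M)
    (f : {linear M -> M'}) :
  (forall x, f x = 0 <-> carrier N x) -> (forall y, exists x, f x = y) ->
  isomorphic (quotmod N) M'.
Proof.
move=> fker fsurj.
have reprE (x : quotmod N) : quot_map N (repr x) = x by exact: reprK.
have liftE x y : quot_map N x = quot_map N y -> f x = f y.
  move=> /eqP; rewrite -subr_eq0 -raddfB => /eqP/quot_map_eq0/fker.
  by rewrite linearB => /eqP; rewrite subr_eq0 => /eqP.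
have gL : linear (fun x : quotmod N => f (repr x)).
  by move=> a x y; rewrite -linearP; apply: liftE; rewrite linearP /= !reprE.
have [g gE] := linear_pack gL.
have [x|y|h [gK hK]] := @linear_inverse _ _ _ g.
- by rewrite gE => /fker/quot_map_eq0; rewrite reprE.
- have [x <-] := fsurj y; exists (quot_map N x); rewrite gE.
  by apply: liftE; rewrite reprE.
- by exists g, h.
Qed.

(** * Coordinates, denominators and saturation *)

Lemma coordsZ (R : idomainType) (M : lmodType R) n (b : basis M n) (a : R) x :
  coords b (a *: x) = a *: coords b x.
Proof. exact: linearZ. Qed.

Lemma coords_sum (R : idomainType) (M : lmodType R) n (b : basis M n) m
    (x : 'I_m -> M) :
  coords b (\sum_i x i) = \sum_i coords b (x i).
Proof. exact: raddf_sum. Qed.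

Lemma matrix_ofP (R : idomainType) (M M' : lmodType R) n n' (b : basis M n)
    (b' : basis M' n') (f : {linear M -> M'}) x :
  coords b' (f x) = matrix_of b b' f *m coords b x.
Proof.
rewrite -{1}(coordsK b x); set v := coords b x.
rewrite {1}(matrix_sum_delta v) !linear_sum /=; apply/matrixP => i k.
rewrite ord1 summxE !mxE; apply: eq_bigr => j _.
by rewrite big_ord_recl big_ord0 addr0 !linearZ /= !mxE mulrC ord1.
Qed.

Lemma coords_inj (R : nzRingType) (M : lmodType R) n (b : basis M n) :
  injective (coords b).
Proof. exact: can_inj (coordsK b). Qed.

Lemma scalemx_eq0 (R : idomainType) m n (a : R) (A : 'M[R]_(m, n)) :
  a != 0 -> a *: A = 0 -> A = 0.
Proof.
move=> a0 aA; apply/matrixP => i j; move/matrixP: aA => /(_ i j)/eqP.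
by rewrite !mxE mulf_eq0 (negPf a0) => /eqP.
Qed.

Lemma scale_basis_eq0 (R : idomainType) (M : lmodType R) n (b : basis M n)
    (a : R) (x : M) :
  a != 0 -> a *: x = 0 -> x = 0.
Proof.
move=> a0 ax; apply: (coords_inj (b := b)); rewrite linear0.
by apply: (scalemx_eq0 a0); rewrite -linearZ ax linear0.
Qed.

Lemma fracP (R : idomainType) (x : {fraction R}) :
  exists n d : R, d != 0 /\ tofrac d * x = tofrac n.
Proof.
exists \n_(repr x), \d_(repr x); split; first exact: denom_ratioP.
rewrite -[in LHS](reprK x); set y := repr x; unlock tofrac.
rewrite -[_ * _]/(FracField.mul _ _) piE; apply/eqmodP => /=.
rewrite FracField.equivfE /FracField.mulf.
rewrite /y reprK !numden_Ratio ?mulf_neq0 ?denom_ratioP ?oner_neq0 //.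
by rewrite mulr1 mul1r.
Qed.

Lemma clear_denominators (R : idomainType) m n (A : 'M[{fraction R}]_(m, n)) :
  exists d (B : 'M[R]_(m, n)), d != 0 /\ tofrac d *: A = toK B.
Proof.
have /choice[f fP] (p : 'I_m * 'I_n) : exists q : R * R,
    q.2 != 0 /\ tofrac q.2 * A p.1 p.2 = tofrac q.1.
  by have [u [v uv]] := fracP (A p.1 p.2); exists (u, v).
pose d := \prod_p (f p).2.
(* The common denominator is the product of all denominators; each numerator gets multiplied by the
   denominators of the other entries. *)
exists d, (\matrix_(i, j) (\prod_(p | p != (i, j)) (f p).2 * (f (i, j)).1)).
split; first by apply/prodf_neq0 => p _; case: (fP p).
apply/matrixP => i j; rewrite !mxE tofracM -(fP (i, j)).2 /= mulrA -tofracM.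
by rewrite /d (bigD1 (i, j)) //= [X in tofrac X * _]mulrC.
Qed.

Lemma toK_inj (R : idomainType) m n : injective (@toK R m n).
Proof.
move=> A B /matrixP AB; apply/matrixP => i j; apply/eqP.
by rewrite -tofrac_eq; have := AB i j; rewrite !mxE => ->.
Qed.

Lemma toKZ (R : idomainType) m n (a : R) (A : 'M[R]_(m, n)) :
  toK (a *: A) = tofrac a *: toK A.
Proof. exact: map_mxZ. Qed.

Lemma toKM (R : idomainType) m n p (A : 'M[R]_(m, n)) (B : 'M[R]_(n, p)) :
  toK (A *m B) = toK A *m toK B.
Proof. exact: map_mxM. Qed.

Lemma toK_sum (R : idomainType) m n p (A : 'I_p -> 'M[R]_(m, n)) :
  toK (\sum_i A i) = \sum_i toK (A i).
Proof. exact: raddf_sum. Qed.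

(** Clearing the denominators of a combination over K gives [s]; conversely, x = (1/s)(s x) is a
    one-term combination. Membership no longer refers to the fraction field. *)
Lemma saturationP (R : idomainType) (M : lmodType R) n (b : basis M n)
    (N : submod M) x :
  carrier (saturation b N) x <-> exists2 s : R, s != 0 & carrier N (s *: x).
Proof.
split=> [[m [y [c [Ny xE]]]]|[s s0 Nsx]].
  have [d [e [d0 eE]]] := clear_denominators (\row_i c i).
  exists d => //; have -> : d *: x = \sum_i e 0 i *: y i.
    apply: (coords_inj (b := b)); apply: toK_inj.
    rewrite coordsZ coords_sum toKZ xE scaler_sumr toK_sum.
    apply: eq_bigr => i _; rewrite coordsZ toKZ scalerA; congr (_ *: _).
    by move/matrixP: eE => /(_ 0 i); rewrite !mxE.
  by elim/big_rec: _ => [|i z _ IH]; [apply: submod0 | apply: submodP].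
exists 1%N, (fun=> s *: x), (fun=> (tofrac s)^-1); split=> //.
rewrite big_ord1 coordsZ toKZ scalerA mulVf ?scale1r //.
by rewrite tofrac_eq0.
Qed.

(** * Kernels of matrices over a principal ideal domain *)

(** The values of the form [f] make up an ideal, generated by [g]. The entries of [f] are its values
    at unit vectors, hence multiples of [g], and [v] is a preimage of [g]. *)
Lemma row_ideal (R : idomainType) n (f : 'rV[R]_n) :
  principal_ideal_domain R ->
  exists (g : R) (c : 'rV[R]_n) (v : 'cV[R]_n), f = g *: c /\ f *m v = g%:M.
Proof.
move=> pid.
pose K : set R^o := [set u | exists v : 'cV[R]_n, f *m v = u%:M].
have K0 : K 0 by exists 0; rewrite mulmx0 raddf0.
have KP a x y : K x -> K y -> K (a *: x + y).
  move=> [v fv] [w fw]; exists (a *: v + w).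
  by rewrite mulmxDr -scalemxAr fv fw scale_scalar_mx raddfD.
have [g gE] := pid (Submod K0 KP).
have gP u : (exists v : 'cV[R]_n, f *m v = u%:M) <-> exists a, a * g = u.
  have -> : (exists v : 'cV[R]_n, f *m v = u%:M) = [set a * g | a in setT] u.
    by rewrite -gE.
  by split=> [[a _ <-]|[a <-]]; exists a.
have [v fv] : exists v : 'cV[R]_n, f *m v = g%:M.
  by apply/gP; exists 1; rewrite mul1r.
have /choice[c cE] j : exists u, u * g = f 0 j.
  apply/gP; exists (delta_mx j 0); rewrite -colE; apply/matrixP => i k.
  by rewrite !ord1 !mxE eqxx mulr1n.
exists g, (\row_j c j), v; split=> //.
by apply/rowP => j; rewrite !mxE mulrC cE.
Qed.

(* Over a PID the image of a linear form is generated by one element g, and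
   subtracting a multiple of a preimage of g kills the form. *)
Lemma kernel_projection (R : idomainType) m n (A : 'M[R]_(m, n)) :
  principal_ideal_domain R ->
  exists P : 'M[R]_n, A *m P = 0 /\ forall x : 'cV_n, A *m x = 0 -> P *m x = x.
Proof.
move=> pid; elim: m A => [|m IH] A.
  by exists 1%:M; split=> [|x _]; rewrite ?mul1mx // [A]flatmx0 mul0mx.
rewrite -[m.+1]/(1 + m)%N in A *; rewrite -(vsubmxK A).
set f := usubmx A; set B := dsubmx A; have [P [BP PE]] := IH B.
have [g [c [v [fP fPv]]]] := row_ideal (f *m P) pid.
(* If g = 0, the first row already vanishes on the image of [P], the projection onto the kernel of
   the other rows. *)
have [g0|g0] := eqVneq g 0.
  exists P; rewrite mul_col_mx BP fP g0 scale0r col_mx0; split=> // x.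
  by rewrite mul_col_mx -(col_mx0 R) => /eq_col_mx[_ /PE].
exists (P - P *m v *m c); split.
  rewrite mul_col_mx !mulmxBr !mulmxA BP !mul0mx subrr fPv fP.
  by rewrite mul_scalar_mx subrr col_mx0.
move=> x; rewrite mul_col_mx -(col_mx0 R) => /eq_col_mx[fx /PE Px].
(* g c x = f P x = f x = 0, so the correction term does not move [x]. *)
have cx : c *m x = 0.
  by apply: (scalemx_eq0 g0); rewrite scalemxAl -fP -mulmxA Px.
by rewrite mulmxBl Px -!mulmxA cx !mulmx0 subr0.
Qed.

Lemma saturation_range_ker (R : idomainType) (M M' : lmodType R) n n'
    (b : basis M n) (b' : basis M' n') (f : {linear M -> M'}) :
  exists A : 'M[R]_n', forall x,
    carrier (saturation b' (range_submod f)) x <-> A *m coords b' x = 0.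
Proof.
set D := matrix_of b b' f.
(* The matrix [cokermx] tests membership in a row space, whereas cochains are columns: hence the
   transposes. *)
have [s [B [s0 BE]]] := clear_denominators (cokermx (toK D)^T).
have toKT p q (X : 'M[R]_(p, q)) : toK X^T = (toK X)^T by rewrite /toK map_trmx.
exists B^T => x; rewrite saturationP; split=> [[t t0 [y _ fy]]|Bx].
  have DB : D^T *m B = 0.
    apply: toK_inj; rewrite toKM -BE toKT -scalemxAr mulmx_coker scaler0.
    by rewrite /toK map_mx0.
  apply: (scalemx_eq0 t0); rewrite scalemxAr -coordsZ -fy (matrix_ofP b) -/D mulmxA.
  by rewrite -[D]trmxK -trmx_mul DB trmx0 mul0mx.
have : (toK (coords b' x)^T <= (toK D)^T)%MS.
  rewrite submxE; apply/eqP; apply: (@scalemx_eq0 _ _ _ (tofrac s)).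
    by rewrite tofrac_eq0.
  rewrite scalemxAr BE -toKM -[B]trmxK -trmx_mul Bx trmx0.
  by rewrite /toK map_mx0.
(* [w] is a preimage of [x] over K; clearing its denominators gives a preimage of e x over R. *)
move=> /submxP[w wE]; have [e [v [e0 vE]]] := clear_denominators w.
exists e => //; exists (vec b v^T) => //; apply: (coords_inj (b := b')).
rewrite (matrix_ofP b) -/D vecK coordsZ; apply: trmx_inj; apply: toK_inj.
by rewrite trmx_mul trmxK toKM -vE linearZ toKZ toKT wE -scalemxAl.
Qed.

(** The matrix of [kernel_projection] acts as an idempotent whose fixed points are [S]; its kernel
    is the complement. *)
Lemma ker_direct_summand (R : idomainType) (M : lmodType R) m n (b : basis M n)
    (A : 'M[R]_(m, n)) (S : submod M) :
  principal_ideal_domain R ->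
  (forall x, carrier S x <-> A *m coords b x = 0) -> direct_summand S.
Proof.
move=> pid SE; have [P [AP PE]] := kernel_projection A pid.
have PP (y : 'cV_n) : P *m (P *m y) = P *m y.
  by apply: PE; rewrite mulmxA AP mul0mx.
have [p pE] : {p : {linear M -> M} | forall x, p x = vec b (P *m coords b x)}.
  by exists (endo_of b P).
have pp x : p (p x) = p x by rewrite !pE vecK PP.
have Sp x : carrier S x <-> p x = x.
  rewrite SE pE; split=> [/PE->|]; first exact: coordsK.
  by move/(congr1 (coords b)); rewrite vecK => <-; rewrite mulmxA AP mul0mx.
exists (ker_submod p); split; last first.
  move=> x; exists (p x), (x - p x); split; first exact/Sp.
    by rewrite /= linearB pp subrr.
  by rewrite addrC subrK.
apply/seteqP; split=> [x [/Sp px p0]|_ ->]; first by rewrite /= -px.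

by split; [apply: submod0 | rewrite /= linear0].
Qed.

(** * Minimality of the saturation *)

Lemma saturation_subset_summand (R : idomainType) (M : lmodType R) n
    (b : basis M n) (N T : submod M) :
  direct_summand T -> N `<=` T -> saturation b N `<=` T.
Proof.
move=> [T' [TT' TD]] NT x /saturationP[s s0 /NT Tsx].
have [t [t' [Tt T't' xE]]] := TD x.
(* s t' = s x - s t lies in both summands, hence vanishes, and [M] is torsion-free. *)
have /(scale_basis_eq0 b s0) t'0 : s *: t' = 0.
  have : (T `&` T') (s *: t'); last by rewrite TT'.
  split.
    rewrite (_ : s *: t' = (- s) *: t + s *: x); first exact: submodP.
    by rewrite xE scalerDr addrA scaleNr addNr add0r.
  by rewrite -[s *: t']addr0; apply: submodP => //; apply: submod0.
by rewrite xE t'0 addr0.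
Qed.

(** The saturation lies in every summand containing [N]: it is the least one, hence the only minimal
    one. *)
Lemma saturation_unique_minimal_summand (R : idomainType) (M : lmodType R) n
    (b : basis M n) (N : submod M) :
  direct_summand (saturation b N) ->
  unique_minimal_summand_containing N (saturation b N).
Proof.
move=> satD.
have satN : N `<=` saturation b N.
  by move=> x Nx; apply/saturationP; exists 1; rewrite ?oner_neq0 ?scale1r.
split=> [|T [TD NT Tmin]].
  split=> // T TD NT Tsat; apply/seteqP; split=> //.
  exact: saturation_subset_summand.
by apply/esym/Tmin => //; apply: saturation_subset_summand.
Qed.

(** * Torsion of the quotient *)

Lemma torsion_quotP (R : idomainType) (M : lmodType R) n (b : basis M n)
    (N : submod M) x :
  carrier (torsion (quotmod N)) (quot_map N x) <-> carrier (saturation b N) x.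
Proof.
rewrite saturationP; split=> -[s s0 sx]; exists s => //.
  by apply/quot_map_eq0; rewrite linearZ.
by rewrite -linearZ; apply/quot_map_eq0.
Qed.

(** The quotient map restricted to the saturation has kernel [N] and, by [torsion_quotP], reaches
    exactly the torsion classes. *)
Lemma saturation_quot_torsion (R : idomainType) (M : lmodType R) n
    (b : basis M n) (N : submod M) :
  isomorphic (subquot (saturation b N) N) (submod_sort (torsion (quotmod N))).
Proof.
have [|f fE] := @corestrict _ _ _ (torsion (quotmod N))
  (quot_map N \o (val : {linear submod_sort (saturation b N) -> M})).
  by move=> [x xs]; apply/(torsion_quotP b)/asboolP.
apply: (@quotmod_isomorphic _ _ _ _ f) => [x|y].
  split=> [/(congr1 (@submod_val _ _ _))|xN].
    by rewrite fE => /quot_map_eq0.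
  by apply: val_inj; rewrite /= fE; apply/quot_map_eq0.
have [x xE] := quot_mapK (submod_val y).
have xS : x \in submod_pred (saturation b N).
  by apply/asboolP/torsion_quotP; rewrite -xE; apply/asboolP/submod_valP.
by exists (SubmodSort xS); apply: val_inj; rewrite /= fE xE.
Qed.

(** * Images and kernels from a split pseudo-inverse *)

(* Over the fraction field, d' / p is a generalized inverse of d, with d d' / p
   the projection onto the image and 1 - d' d / p the one onto the kernel. *)
Record split_pseudo_inverse (R : idomainType) (M M' : lmodType R)
    (d : {linear M -> M'}) (d' : {linear M' -> M}) (P : {linear M' -> M'})
    (Q : {linear M -> M}) (p : R) : Prop := {
  pinv_neq0 : p != 0;
  pinvr : forall y, d (d' y) = p *: P y;
  pinvP : forall x, P (d x) = d x;
  pinvl : forall x, d' (d x) = p *: (x - Q x);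
  pinvQ : forall x, d (Q x) = 0
}.

Lemma pinv_ker (R : idomainType) (M M' : lmodType R) n (b : basis M n)
    (d : {linear M -> M'}) d' P Q p :
  split_pseudo_inverse d d' P Q p -> range Q = ker_submod d.
Proof.
move=> [p0 _ _ d'd dQ]; apply/seteqP; split=> [_ [x _ <-]|x dx]; first exact: dQ.
exists x => //; apply/eqP; rewrite eq_sym -subr_eq0; apply/eqP.
by apply: (scale_basis_eq0 b p0); rewrite -d'd dx linear0.
Qed.

Lemma pinv_saturation (R : idomainType) (M M' : lmodType R) n (b : basis M' n)
    (d : {linear M -> M'}) d' P Q p :
  split_pseudo_inverse d d' P Q p -> range P = saturation b (range_submod d).
Proof.
move=> [p0 dd' Pd _ _]; apply/seteqP; split=> [_ [x _ <-]|x].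
  by apply/saturationP; exists p => //; exists (d' x).
(* If s x = d y, then s (P x - x) = P (d y) - d y = 0, so [P] fixes [x]. *)
move=> /saturationP[s s0 [y _ dy]]; exists x => //.
apply/eqP; rewrite -subr_eq0; apply/eqP/(scale_basis_eq0 b s0).
by rewrite scalerBr -linearZ -dy Pd subrr.
Qed.

Lemma pinv_idem (R : idomainType) (M M' : lmodType R) n (b : basis M' n)
    (d : {linear M -> M'}) d' P Q p x :
  split_pseudo_inverse d d' P Q p -> P (P x) = P x.
Proof.
move=> [p0 dd' Pd _ _]; apply/eqP; rewrite -subr_eq0.
apply/eqP/(scale_basis_eq0 b p0).
by rewrite scalerBr -linearZ -dd' Pd subrr.
Qed.

(** The maps [J] and [I] factor the projection [P'] through R^k, which makes its range free; the
    free part is the image of that range under the quotient map. *)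
Lemma pinv_free_part (R : idomainType) (M M' : lmodType R) n k (b : basis M' n)
    (d : {linear M -> M'}) d' P Q p (P' : {linear M' -> M'})
    (J : {linear 'cV[R]_k -> M'}) (I : {linear M' -> 'cV[R]_k}) :
  split_pseudo_inverse d d' P Q p ->
  (forall y, P' y = y - P y) -> cancel J I -> (forall y, J (I y) = P' y) ->
  exists L : submod (quotmod (range_submod d)),
    free_part L /\ set_bij (range P') L (quot_map (range_submod d)).
Proof.
move=> pinv P'E JK IK; have [p0 dd' Pd _ _] := pinv.
set q := quot_map _.
have PP y : P (P y) = P y := pinv_idem b y pinv.
have PP' y : P (P' y) = 0 by rewrite P'E linearB PP subrr.
(* An element of im d is fixed by [P], whereas [P] kills the range of [P']. *)
have q0 y : q (P' y) = 0 -> P' y = 0.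
  by move=> /quot_map_eq0[x _ dx]; rewrite -(PP' y) -dx Pd.
have P'J z : P' (J z) = J z by rewrite -IK JK.
pose L := range_submod (q \o P').
exists L; split; last first.
  split=> [_ [y _ <-]|u v|_ [y _ <-]]; first by exists y.
    rewrite !inE => -[y _ <-] [z _ <-] /eqP.
    rewrite -subr_eq0 -!linearB => /eqP/q0/eqP.
    by rewrite linearB subr_eq0 => /eqP.
  by exists (P' y) => //; exists y.
split.
  (* The map q J, seen as landing in [L], is bijective; its inverse gives the coordinates of a basis
     of [L]. *)
  have [z|g gE] := @corestrict _ _ _ L (q \o J).
    by exists (J z) => //=; rewrite P'J.
  have [z|y|h [gK hK]] := @linear_inverse _ _ _ g.
  - move=> /(congr1 (@submod_val _ _ _)); rewrite gE /= -P'J => /q0.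
    by rewrite P'J => Jz; rewrite -[z]JK Jz linear0.
  - have /asboolP[x _ xE] := submod_valP y.
    by exists (I x); apply: val_inj; rewrite /= gE -xE /= IK.
  - by exists k; split; exact: (Basis hK gK).
have torsE x : carrier (torsion _) (q x) <-> range P x.
  by rewrite (pinv_saturation b pinv); apply: torsion_quotP.
split.
  apply/seteqP; split=> [_ [[y _ <-]] /torsE[z _ zE]|_ ->].
    by rewrite /= -zE -PP zE PP' linear0.
  by split; apply: submod0.
move=> x; have [y ->] := quot_mapK x.
exists (q (P' y)), (q (P y)); split; first by exists y.
  by apply/torsE; exists y.
by rewrite -linearD P'E subrK.
Qed.

(** * Smith matrices and diagonal idempotents *)

(** Complementary exponents turn every nonzero diagonal entry into pi^N, which inverts a Smith
    matrix on its first [r] coordinates up to that factor. *)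
Lemma smith_mxM (R : comNzRingType) (pi : R) n n' r (a b : r.-tuple nat) N :
  (r <= n)%N -> (forall i, i < r -> nth 0 a i + nth 0 b i = N)%N ->
  smith_mx pi n' n a *m smith_mx pi n n' b = pi ^+ N *: first_ones R n' r.
Proof.
move=> rn abN; apply/matrixP => i k; rewrite !mxE.
have [ir|ri] := boolP (i < r)%N; last first.
  by rewrite mul0rn mulr0 big1 // => j _; rewrite !mxE (negPf ri) andbF mul0r.
rewrite (bigD1 (Ordinal (leq_trans ir rn))) //= big1 ?addr0 => [|j ji].
  rewrite !mxE /= eqxx ir andbT -val_eqE /=; case: eqP => _; last by rewrite !mulr0.
  by rewrite -exprD abN // mulr1.
by move: ji; rewrite !mxE -val_eqE eq_sym => /negPf/= ->; rewrite mul0r.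
Qed.

Lemma first_ones_smith (R : comNzRingType) (pi : R) n n' r (a : r.-tuple nat) :
  first_ones R n' r *m smith_mx pi n' n a = smith_mx pi n' n a.
Proof.
apply/matrixP => i j; rewrite mul_diag_mx !mxE.
by case: (i < r)%N; rewrite ?andbF ?mul1r ?mulr0.
Qed.

Lemma smith_last_ones (R : comNzRingType) (pi : R) n n' r (a : r.-tuple nat) :
  smith_mx pi n' n a *m last_ones R n r = 0.
Proof.
apply/matrixP => i j; rewrite mul_mx_diag !mxE [(r <= j)%N]leqNgt.
case: eqP => [->|]; last by rewrite mul0r.
by case: (j < r)%N; rewrite /= ?mulr0n ?mulr0 ?mul0r.
Qed.

Lemma last_onesE (R : comNzRingType) n r :
  last_ones R n r = 1%:M - first_ones R n r.
Proof.
apply/matrixP => i j; rewrite !mxE [(r <= i)%N]leqNgt.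
by case: eqP; case: (i < r)%N; rewrite ?subrr ?subr0.
Qed.

Lemma last_ones_factor (R : comNzRingType) n r :
  exists (J : 'M[R]_(n, n - r)) (I : 'M[R]_(n - r, n)),
    I *m J = 1%:M /\ J *m I = last_ones R n r.
Proof.
(* [I] extracts the last n - r coordinates and its transpose puts them back. For r > n the truncated
   difference is 0, and [last_ones] vanishes too. *)
pose I : 'M[R]_(n - r, n) := \matrix_(i, j) (j == r + i :> nat)%N%:R.
exists I^T, I; split; apply/matrixP => i j; rewrite !mxE.
  have ri : (r + i < n)%N by rewrite -ltn_subRL.
  rewrite (bigD1 (Ordinal ri)) //= big1 ?addr0 => [|k].
    by rewrite !mxE /= eqxx mul1r eqn_add2l.
  by rewrite -val_eqE !mxE /= => /negPf->; rewrite mul0r.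
have [ri|ir] := leqP r i; last first.
  rewrite mul0rn big1 // => k _; rewrite !mxE.
  by rewrite ltn_eqF ?mul0r // (leq_trans ir) ?leq_addr.
have irn : (i - r < n - r)%N by rewrite ltn_sub2r // (leq_ltn_trans ri).
rewrite (bigD1 (Ordinal irn)) //= big1 ?addr0 => [|k].
  by rewrite !mxE /= subnKC // eqxx mul1r eq_sym.
rewrite -val_eqE !mxE /= => ki; case: eqP => [iE|]; last by rewrite mul0r.
by rewrite iE addKn eqxx in ki.
Qed.

Lemma idem_conj (R : comUnitRingType) n (V E : 'M[R]_n) :
  V \in unitmx -> E *m E = E ->
  (V *m E *m invmx V) *m (V *m E *m invmx V) = V *m E *m invmx V.
Proof. by move=> VU EE; rewrite !mulmxA mulmxKV // -(mulmxA V E E) EE. Qed.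

Lemma idem_compl (R : nzRingType) n (P : 'M[R]_n) :
  P *m P = P -> (1%:M - P) *m (1%:M - P) = 1%:M - P.
Proof. by move=> PP; rewrite mulmxBl mul1mx mulmxBr mulmx1 PP subrr subr0. Qed.

Lemma first_ones_idem (R : comNzRingType) n r :
  first_ones R n r *m first_ones R n r = first_ones R n r.
Proof.
apply/matrixP => i j; rewrite mul_diag_mx !mxE.
by case: (i < r)%N; rewrite ?mul1r ?mul0r ?mul0rn.
Qed.

Lemma uniformizer_neq0 (R : idomainType) (pi : R) : uniformizer pi -> pi != 0.
Proof.
move=> [m [_ mN0] gm]; apply/eqP => pi0; apply: mN0.
rewrite gm pi0; apply/seteqP; split=> [_ [x _ <-]|_ ->]; first exact: mulr0.
by exists 0; rewrite ?mulr0.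
Qed.

Lemma smith_pinv (R : idomainType) (pi : R) (M M' : lmodType R) n n'
    (b : basis M n) (b' : basis M' n') (d : {linear M -> M'}) r
    (a : r.-tuple nat) (U : 'M[R]_n') (V : 'M[R]_n) :
  pi != 0 -> U \in unitmx -> V \in unitmx -> (r <= n)%N -> (r <= n')%N ->
  U *m matrix_of b b' d *m V = smith_mx pi n' n a ->
  exists d' p, split_pseudo_inverse d d'
    (endo_of b' (invmx U *m first_ones R n' r *m U))
    (endo_of b (V *m last_ones R n r *m invmx V)) p.
Proof.
move=> pi0 UU VU rn rn'; set D := matrix_of b b' d => UDV.
have DE : D = invmx U *m smith_mx pi n' n a *m invmx V.
  by rewrite -UDV !mulmxA mulVmx // mul1mx mulmxK.
(* Taking the largest exponent ensures that no subtraction N - a_i is truncated. *)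
pose N := (\max_(i < r) nth 0 a i)%N.
pose c : r.-tuple nat := [tuple of map (subn N) a].
have acN i : (i < r -> nth 0 a i + nth 0 c i = N)%N.
  move=> ir; rewrite (nth_map 0%N) ?size_tuple // subnKC //.
  exact: (leq_bigmax (Ordinal ir)).
have caN i : (i < r -> nth 0 c i + nth 0 a i = N)%N by move=> /acN; rewrite addnC.
pose D' := V *m smith_mx pi n n' c *m U.
exists (vec b \o mulmx D' \o coords b'), (pi ^+ N).
have dE x : d x = vec b' (D *m coords b x) by rewrite -matrix_ofP coordsK.
split.
- by rewrite expf_neq0.
- move=> y; rewrite dE /= vecK mulmxA -linearZ /= scalemxAl; congr (vec b' (_ *m _)).
  rewrite DE /D' !mulmxA mulmxKV // -(mulmxA (invmx U) (smith_mx _ _ _ _)).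
  by rewrite (smith_mxM pi n' rn acN) -scalemxAr -scalemxAl.
- move=> x; rewrite dE /= vecK mulmxA; congr (vec b' (_ *m _)).
  by rewrite DE !mulmxA mulmxK // -(mulmxA _ (first_ones _ _ _)) first_ones_smith.
- move=> x; apply: (coords_inj (b := b)).
  rewrite coordsZ linearB dE /= !vecK mulmxA.
  rewrite -[X in X - _]mul1mx -mulmxBl scalemxAl; congr (_ *m _).
  rewrite DE /D' !mulmxA mulmxK // -(mulmxA V (smith_mx _ _ _ _)).
  rewrite (smith_mxM pi n rn' caN) last_onesE mulmxBr mulmx1 mulmxBl mulmxV //.
  by rewrite subKr -scalemxAr -scalemxAl.
- move=> x; rewrite dE /= vecK mulmxA DE !mulmxA mulmxKV //.
  by rewrite -(mulmxA (invmx U)) smith_last_ones mulmx0 !mul0mx linear0.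
Qed.

(** * Reduction modulo powers of the uniformizer, and assembly *)

(** Reduction is a ring morphism applied entrywise, so it respects products of matrices over R. *)
Lemma residue_endo (R : idomainType) (pi : R) (hpi : uniformizer pi) k
    (hk : (0 < k)%N) (M : lmodType R) n (b : basis M n) (A : 'M[R]_n) x :
  residue_mx hpi hk (coords b (endo_of b A x)) =
  residue_mx hpi hk A *m residue_mx hpi hk (coords b x).
Proof. by rewrite /= vecK; exact: map_mxM. Qed.

Theorem theoremB (R : idomainType) (pi : R)
    (hR : discrete_valuation_ring R) (hpi : uniformizer pi)
    (G : graph) (F : sheaf R G) (o : orientation G)
    (n0 n1 : nat) (b0 : basis (C0 F) n0) (b1 : basis (C1 F) n1) :
  let d : {linear C0 F -> C1 F} := coboundary o in
  let imd : submod (C1 F) := range_submod d in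
  let sat_imd : submod (C1 F) := saturation b1 imd in
  let D : 'M[R]_(n1, n0) := matrix_of b0 b1 d in
  unique_minimal_summand_containing imd sat_imd /\
  forall (r : nat) (a : r.-tuple nat) (U : 'M[R]_n1) (V : 'M[R]_n0),
    U \in unitmx -> V \in unitmx ->
    r = \rank (toK D) -> sorted leq a ->
    U *m D *m V = smith_mx pi n1 n0 a ->
    let Pker : 'M[R]_n0 := V *m last_ones R n0 r *m invmx V in
    let Psat : 'M[R]_n1 := invmx U *m first_ones R n1 r *m U in
    let Pfree : 'M[R]_n1 := 1%:M - Psat in
    let Piker : {linear C0 F -> C0 F} := endo_of b0 Pker in
    let Pisat : {linear C1 F -> C1 F} := endo_of b1 Psat in
    let Pifree : {linear C1 F -> C1 F} := endo_of b1 Pfree in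
    let q : {linear C1 F -> H1 F o} := quot_map imd in
    [/\ Pker *m Pker = Pker, Psat *m Psat = Psat & Pfree *m Pfree = Pfree] /\
    [/\ range Piker = H0 F o,
        range Pisat = sat_imd,
        exists L : submod (H1 F o), free_part L /\ set_bij (range Pifree) L q,
        isomorphic (subquot sat_imd imd) (submod_sort (torsion (H1 F o)))
      & forall (k : nat) (hk : (0 < k)%N),
          [/\ forall x : C0 F, residue_mx hpi hk (coords b0 (Piker x)) =
                residue_mx hpi hk Pker *m residue_mx hpi hk (coords b0 x),
              forall x : C1 F, residue_mx hpi hk (coords b1 (Pisat x)) =
                residue_mx hpi hk Psat *m residue_mx hpi hk (coords b1 x)
            & forall x : C1 F, residue_mx hpi hk (coords b1 (Pifree x)) =
                residue_mx hpi hk Pfree *m residue_mx hpi hk (coords b1 x)]].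
Proof.
move=> d imd sat_imd D; have [pid _] := hR; split.
  apply: saturation_unique_minimal_summand.
  have [A AE] := saturation_range_ker b0 b1 d.
  exact: ker_direct_summand pid AE.
move=> r a U V UU VU rE _ UDV Pker Psat Pfree Piker Pisat Pifree q.
have rn0 : (r <= n0)%N by rewrite rE rank_leq_col.
have rn1 : (r <= n1)%N by rewrite rE rank_leq_row.
have [d' [p pinv]] := smith_pinv (uniformizer_neq0 hpi) UU VU rn0 rn1 UDV.
have PkerI : Pker *m Pker = Pker.
  by apply: idem_conj => //; rewrite last_onesE; apply/idem_compl/first_ones_idem.
have PsatI : Psat *m Psat = Psat.
  (* Writing each right factor [U] as the inverse of its inverse shows [Psat] as a conjugate by
     [invmx U]. *)
  rewrite /Psat -{2 4 6}[U]invmxK; apply: idem_conj; rewrite ?unitmx_inv //.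
  exact: first_ones_idem.
split; first by split=> //; apply: idem_compl.
split.
- exact: (pinv_ker b0 pinv).
- exact: (pinv_saturation b1 pinv).
- have [J [I [IJ JI]]] := last_ones_factor R n1 r.
  (* As [Pfree] is U^-1 E U with E the last ones, factoring E factors [Pfree]; the last n1 - r
     columns of U^-1 thus form a basis of its image. *)
  pose J' : {linear 'cV[R]_(n1 - r) -> C1 F} := vec b1 \o mulmx (invmx U *m J).
  pose I' : {linear C1 F -> 'cV[R]_(n1 - r)} := mulmx (I *m U) \o coords b1.
  apply: (pinv_free_part (J := J') (I := I') b1 pinv).
  + move=> y; apply: (coords_inj (b := b1)).
    by rewrite linearB /= !vecK mulmxBl mul1mx.
  + by move=> y; rewrite /= vecK !mulmxA mulmxK // IJ mul1mx.
  + move=> y; rewrite /= !mulmxA -(mulmxA _ J) JI last_onesE.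
    by rewrite mulmxBr mulmx1 mulmxBl mulVmx.
- exact: saturation_quot_torsion.
- by move=> k hk; split=> x; apply: residue_endo.
Qed.
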